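(* Let $G$ be a finite simple graph with minimum degree $\delta=\delta(G)\geq 2$ and maximum degree $\Delta=\Delta(G)\geq 4\lfloor \delta/2\rfloor$. Then \[ C_{2}(G)\leq\Big(\Delta-2\Big\lfloor\frac{\delta}{2}\Big\rfloor+1\Big)\Big(\Big\lfloor\frac{\delta}{2}\Big\rfloor+1\Big)+\Big\lceil\frac{\delta}{2}\Big\rceil+1 . \] Moreover, the bound is sharp: for every integer $d\geq 4$ there exists a graph $G$ with $\delta(G)=2$ and $\Delta(G)=d$ attaining equality (i.e. $C_2(G)=2d$).
   Context: A set $S\subseteq V(G)$ is a $2$-dominating set of $G$ if every vertex $v\in V(G)\setminus S$ has at least $2$ neighbors in $S$. Two disjoint sets $A,B\subseteq V(G)$ form a $2$-coalition if neither $A$ nor $B$ is a $2$-dominating set of $G$ but $A\cup B$ is a $2$-dominating set of $G$. A $2$-coalition partition of $G$ is a partition $\Theta$ of $V(G)$ such that every set in $\Theta$ is either a $2$-dominating set of cardinality $2$ or forms a $2$-coalition with another set of $\Theta$. $C_2(G)$ is the maximum cardinality of a $2$-coalition partition of $G$. *)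

(* Defs.v *)
From mathcomp Require Import all_boot.

Set Implicit Arguments.
Unset Strict Implicit.
Unset Printing Implicit Defensive.

Record sgraph := SGraph {
  vertex :> finType;
  adj : rel vertex;
  adj_sym : symmetric adj;
  adj_irr : irreflexive adj }.

Section TwoCoalition.
Variable G : sgraph.
Implicit Types (v : G) (S A B : {set G}) (P : {set {set G}}).

Definition neighbours v : {set G} := [set u | adj v u].

Definition degree v : nat := #|neighbours v|.

(* Every degree is < #|G|, so the neutral value #|G| is never the result unless
   G has no vertex, in which case both extremal degrees are 0. *)
Definition min_degree : nat := \big[minn/#|G|]_(v : G) degree v.

Definition max_degree : nat := \max_(v : G) degree v.

Definition two_dominating S : bool :=
  [forall v, (v \notin S) ==> (2 <= #|neighbours v :&: S|)].

Definition two_coalition A B : bool :=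
  [&& [disjoint A & B], ~~ two_dominating A, ~~ two_dominating B
    & two_dominating (A :|: B)].

Definition two_coalition_partition P : bool :=
  partition P [set: G] &&
  [forall A in P, (two_dominating A && (#|A| == 2))
               || [exists B in P, (B != A) && two_coalition A B]].

(* The value is 0 when G has no 2-coalition partition. *)
Definition two_coalition_number : nat :=
  \max_(P : {set {set G}} | two_coalition_partition P) #|P|.

End TwoCoalition.

(* Main.v *)
Require Import Defs.
From mathcomp Require Import all_boot.
From mathcomp Require Import zify.

(** Let the load of a set S at a vertex v be |N(v) :&: S|, plus 2 if v \in S.
Then S is 2-dominating iff all its loads are at least 2, and the loads at v of
the parts of a partition of V(G) add up to deg v + 2. At a vertex v of minimum
degree delta, let p parts have load at least 2, m parts load 1 and z parts load
0, so that 2 p + m <= delta + 2. Each part of load 0 needs a partner, which has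
load at least 2; let s <= p be the number of parts so used. Looking at a vertex
that is not dominated by such a part, one finds that at most Delta + 3 - 2 s of
the z parts are assigned to it. Hence p + m + z is at most
delta + 2 - s + s (Delta + 3 - 2 s), which increases with s up to
s = delta./2 + 1 because Delta >= 4 * delta./2. *)

Set Implicit Arguments.
Unset Strict Implicit.
Unset Printing Implicit Defensive.

(** * Loads of sets at a vertex, and extremal degrees *)

Section Load.
Variable G : sgraph.
Implicit Types (v w : G) (S A B : {set G}) (P : {set {set G}}).

(** Written as a sum of weights over [S], so that additivity over disjoint unions and partitions is
    immediate; the weight 2 of [v] itself makes membership count as being dominated twice. *)
Definition load v S : nat := \sum_(u in S) (2 * (u == v) + adj v u).

Lemma loadE v S : load v S = 2 * (v \in S) + #|neighbours v :&: S|.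
Proof.
rewrite /load big_split /=; congr (_ + _).
  rewrite -big_distrr /=; congr (2 * _).
  case: (boolP (v \in S)) => vS.
    rewrite (bigD1 v) //= eqxx big1 // => u /andP[_ /negbTE ->] //.
  by rewrite big1 // => u uS; case: eqP => // uv; rewrite -uv uS in vS.
rewrite -sum1_card [RHS](eq_bigl (fun u => (u \in S) && adj v u)); last first.
  by move=> u; rewrite !inE andbC.
by rewrite big_mkcondr; apply: eq_bigr => u _; case: (adj v u).
Qed.

Lemma two_dominatingP S : reflect (forall v, 2 <= load v S) (two_dominating S).
Proof.
apply: (iffP forallP) => dom v; have := dom v; rewrite loadE.
  by case: (v \in S) => //= _; apply: leq_addr.
by case: (v \in S).
Qed.

Lemma load_setU v A B : [disjoint A & B] -> load v (A :|: B) = load v A + load v B.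
Proof. by move=> dAB; rewrite /load -bigU //; apply: eq_bigl => u; rewrite !inE. Qed.

Lemma load_partition v P :
  partition P [set: G] -> \sum_(X in P) load v X = degree v + 2.
Proof.
move=> partP; rewrite -(set_partition_big _ partP) /= -/(load v [set: G]).
by rewrite loadE inE setIT addnC.
Qed.

Lemma two_coalition_load v A B : two_coalition A B -> 2 <= load v A + load v B.
Proof.
by case/and4P=> dAB _ _ /two_dominatingP/(_ v); rewrite load_setU.
Qed.

Lemma degree_le_max v : degree v <= max_degree G.
Proof. exact: leq_bigmax. Qed.

Lemma min_degree_le v : min_degree G <= degree v.
Proof.
rewrite /min_degree; have := mem_index_enum v.
elim: (index_enum G) => //= u s IHs; rewrite inE big_cons geq_min.
by case/orP=> [/eqP <-|/IHs ->]; rewrite ?leqnn ?orbT.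
Qed.

Lemma min_degree_ge m :
  m <= #|G| -> (forall v, m <= degree v) -> m <= min_degree G.
Proof.
move=> mG mdeg; rewrite /min_degree; elim/big_ind: _ => // x y mx my.
by rewrite leq_min mx.
Qed.

Lemma min_degree_attained : 0 < #|G| -> exists v, degree v = min_degree G.
Proof.
case/card_gt0P=> v0 _; case: (@arg_minnP _ v0 predT (@degree G)) => // v _ minv.
exists v; apply/eqP; rewrite eqn_leq min_degree_le andbT.
by apply: min_degree_ge => [|u]; [apply: max_card | apply: minv].
Qed.

End Load.

(** * Counting the parts assigned to a common partner *)

Section UpperBound.
Variables (G : sgraph) (P : {set {set G}}) (Z : {set {set G}}).
Variable g : {set G} -> {set G}.
Hypotheses (partP : partition P [set: G]) (ZP : Z \subset P).
Hypothesis gP : forall C, C \in Z -> g C \in P.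
Hypothesis gZ : forall C, C \in Z -> g C \notin Z.
Hypothesis gC : forall C, C \in Z -> two_coalition C (g C).

(* A vertex [w] not dominated by [A] has load at most 1 on [A], hence at least
   1 on each of its partners, and each other pair [B], [C] with [g C = B]
   takes up 2 of the total load [degree w + 2]. *)
Lemma card_partners (A : {set G}) : A \in g @: Z ->
  #|[set C in Z | g C == A]| + 2 * #|g @: Z| <= max_degree G + 3.
Proof.
move=> AK; have /imsetP[C0 C0Z defA] := AK.
have [w] : exists w, ~~ (2 <= load w A).
  apply/existsP; rewrite -negb_forall; have /and4P[_ _ + _] := gC C0Z.
  by rewrite -defA; apply: contra => /forallP domA; apply/two_dominatingP.
rewrite -ltnNge => wA.
pose F (B : {set G}) := load w B + \sum_(C in Z | g C == B) load w C.
have sumF : \sum_(B in g @: Z) F B <= degree w + 2.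
  rewrite -(load_partition w partP) big_split /=.
  have <- : \sum_(C in Z) load w C
            = \sum_(B in g @: Z) \sum_(C in Z | g C == B) load w C.
    by apply: partition_big => C; apply: imset_f.
  rewrite [X in _ <= X](bigID (mem Z)) addnC /=; apply: leq_add.
    rewrite leq_eqVlt; apply/orP; left; apply/eqP; apply: eq_bigl => C.
    by case CZ: (C \in Z); rewrite ?andbF // (subsetP ZP).
  rewrite [X in _ <= X](bigID (mem (g @: Z))) /=; apply: leq_trans (leq_addr _ _).
  rewrite leq_eqVlt; apply/orP; left; apply/eqP; apply: eq_bigl => B.
  case BK: (B \in g @: Z); rewrite ?andbF // andbT.
  by have /imsetP[C CZ ->] := BK; rewrite gP ?gZ.
have FA : 1 + #|[set C in Z | g C == A]| <= F A.
  have ZA : #|[set C in Z | g C == A]| * (2 - load w A)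
            <= \sum_(C in Z | g C == A) load w C.
    rewrite -sum_nat_const (eq_bigl (fun C => (C \in Z) && (g C == A))).
      apply: leq_sum => C /andP[CZ /eqP gCA].
      by have := two_coalition_load w (gC CZ); rewrite gCA leq_subLR addnC.
    by move=> C; rewrite inE.
  (* If [load w A] is 0, each [C] with [g C = A] has load at least 2 at [w]; this yields the extra 1
     only because some such [C], namely [C0], exists. *)
  have : 0 < #|[set C in Z | g C == A]|.
    by apply/card_gt0P; exists C0; rewrite inE C0Z -defA eqxx.
  by rewrite /F; move: ZA wA; case: (load w A) => [|[|//]] /=; lia.
have FB B : B \in g @: Z -> 2 <= F B.
  case/imsetP=> C CZ ->; apply: leq_trans (two_coalition_load w (gC CZ)) _.
  by rewrite addnC leq_add2l (bigD1 C) ?CZ ?eqxx //= leq_addr.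
have : 2 * #|(g @: Z) :\ A| <= \sum_(B in g @: Z | B != A) F B.
  rewrite mulnC -sum_nat_const (eq_bigl (fun B => (B \in g @: Z) && (B != A))).
    by apply: leq_sum => B /andP[/FB].
  by move=> B; rewrite !inE andbC.
have := degree_le_max w; move: sumF; rewrite (bigD1 A) //= (cardsD1 A (g @: Z)) AK.
move: FA; move: (F A) (\sum_(_ in _ | _) _) #|_ :\ _| #|[set _ in _ | _]|.
by move=> {FB} FA S K ZA; lia.
Qed.

Lemma card_partnered :
  #|Z| <= #|g @: Z| * (max_degree G + 3 - 2 * #|g @: Z|).
Proof.
rewrite -sum1_card (partition_big g (mem (g @: Z))) /=; last first.
  by move=> C; apply: imset_f.
rewrite -sum_nat_const; apply: leq_sum => A /card_partners.
rewrite sum1dep_card; move: #|[set _ in _ | _]| #|_ @: _| => z K zK.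
by lia.
Qed.

End UpperBound.

(** * The upper bound at a vertex of minimum degree *)

Lemma two_coalition_partition_bound (G : sgraph) (P : {set {set G}}) :
  2 <= min_degree G -> 4 * (min_degree G)./2 <= max_degree G ->
  two_coalition_partition P ->
  #|P| <= (max_degree G - 2 * (min_degree G)./2 + 1) * ((min_degree G)./2 + 1)
          + uphalf (min_degree G) + 1.
Proof.
move=> min2 max4 /andP[partP /forall_inP coalP].
have [v degv] : exists v : G, degree v = min_degree G.
  (* Without vertices the minimum would be its neutral value [#|G|], which is then 0. *)
  apply: min_degree_attained; rewrite lt0n; apply: contraTneq min2 => G0.
  rewrite /min_degree G0 big_pred0 // => v.
  by have := card0_eq G0 v; rewrite inE.
pose H := [set X in P | 2 <= load v X].
pose M := [set X in P | load v X == 1].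
pose Z := [set X in P | load v X == 0].
(* The default [set0] is never reached on [Z]: load 0 at [v] excludes being 2-dominating, so a
   coalition partner exists. *)
pose g C := odflt set0 [pick B in P | two_coalition C B].
have gE C : C \in Z -> g C \in P /\ two_coalition C (g C).
  rewrite inE => /andP[CP /eqP vC]; rewrite /g; case: pickP => [B /andP[] //|none].
  case/orP: (coalP _ CP) => [/andP[/two_dominatingP/(_ v)]|]; first by rewrite vC.
  by case/exists_inP=> B BP /andP[_ CB]; have := none B; rewrite BP CB.
have gH C : C \in Z -> g C \in H.
  move=> CZ; have [gCP CgC] := gE _ CZ; move: CZ (two_coalition_load v CgC).
  by rewrite !inE gCP /= => /andP[_ /eqP ->].
have ZP : Z \subset P by apply/subsetP => C; rewrite inE => /andP[].
have gZ C : C \in Z -> g C \notin Z.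
  by move/gH; rewrite !inE => /andP[_ vgC]; rewrite negb_and -lt0n (ltnW vgC) orbT.
have leZ := card_partnered partP ZP (fun C CZ => (gE C CZ).1) gZ
  (fun C CZ => (gE C CZ).2).
have leK : #|g @: Z| <= #|H|.
  by apply: subset_leq_card; apply/subsetP => _ /imsetP[C /gH gCH ->].
have cardP : #|P| = #|H| + #|M| + #|Z|.
  rewrite -!sum1_card !(eq_bigl _ _ (fun X => in_set _ X)) !big_mkcondr /=.
  rewrite -!big_split /=; apply: eq_bigr => X _.
  by case: (load v X) => [|[]].
have leHM : 2 * #|H| + #|M| <= min_degree G + 2.
  rewrite -degv -(load_partition v partP) -!sum1_card.
  rewrite !(eq_bigl _ _ (fun X => in_set _ X)) !big_mkcondr /= big_distrr /=.
  rewrite -big_split /=; apply: leq_sum => X _.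
  by case: (load v X) => [|[]].
have := odd_double_half (min_degree G); rewrite uphalf_half.
move: leZ leK cardP leHM max4; move: (min_degree G)./2 (odd _) => k b.
move: (max_degree G) (min_degree G) (#|g @: Z|) => D m s.
move=> leZ leK -> leHM max4 defm.
have sk : s <= k.+1 by lia.
(* With t = k + 1 - s, the right side exceeds the left by t (D - 2 k - 2 s). This vanishes for t =
   0; otherwise s <= k, and D >= 4 k makes it nonnegative. *)
have key : s * (D + 3 - 2 * s) <= (D - 2 * k + 1) * (k + 1) + s - (k + 1).
  have [t defk] : exists t, k.+1 = s + t by exists (k.+1 - s); lia.
  have [c ->] : exists c, D = 4 * k + c by exists (D - 4 * k); lia.
  case: t defk => [|t] defk; first by nia.
  have -> : k = s + t by lia.
  have -> : 4 * (s + t) + c + 3 - 2 * s = 2 * s + 4 * t + c + 3 by lia.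
  have -> : 4 * (s + t) + c - 2 * (s + t) + 1 = 2 * s + 2 * t + c + 1 by lia.
  nia.
(* From [s <= #|H|] and [leHM], [#|H| + #|M|] is at most [m + 2 - s]. Adding [key] cancels [s] and
   leaves [m - k + 1], which is [uphalf m + 1]. *)
nia.
Qed.

(** * Graphs attaining the bound, with d = [n.+1] *)

Section Sharpness.
Variable n : nat.

(* In the vertex [(o, s, k)], [s] is the side. For [k = Some t] it belongs to
   the 4-cycle number [o]; the vertices [(None, s, None)] are the two vertices
   of maximum degree, each adjacent to the other and to all [(Some i, ~~ s,
   None)]. The two large sets of the partition are made of the cycle vertices
   and of the vertex [(None, s, None)] of each side; each singleton
   [(Some i, s, None)] is a partner of the large set of its side. *)
Definition sharp_vertex : finType := (option 'I_n * bool * option bool)%type.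

(** The vertex [(Some i, s, None)] sees both cycle vertices of its side but only the [Some true] one
    opposite, where the vertex of maximum degree supplies a second neighbour; this keeps its degree
    at 4. The cycle of index [None] is a separate component and provides vertices of degree 2. *)
Definition sharp_adj (x y : sharp_vertex) : bool :=
  let: (o, s, k) := x in let: (o', s', k') := y in
  match k, k' with
  | Some _, Some _ => (o == o') && (s != s')
  | Some t, None | None, Some t => [&& o == o', o != None & (s == s') || t]
  | None, None => (s != s') && ((o == None) || (o' == None))
  end.

Lemma sharp_adj_sym : symmetric sharp_adj.
Proof.
move=> [[o s] k] [[o' s'] k'] /=.
have [oo' ss'] := (eq_sym o o', eq_sym s s').
case: k k' => [t|] [t'|]; rewrite ?ss' ?oo' //.
- by case: eqP => // ->.
- by case: eqP => // ->.
- by rewrite orbC.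
Qed.

Lemma sharp_adj_irr : irreflexive sharp_adj.
Proof. by move=> [[o s] [t|]] /=; rewrite !eqxx ?andbF. Qed.

Definition sharp_graph : sgraph := SGraph sharp_adj_sym sharp_adj_irr.

Implicit Types x y z : sharp_graph.

Lemma two_neighbours (S : {set sharp_graph}) x y z :
    y <> z -> adj x y -> adj x z -> y \in S -> z \in S ->
  2 <= #|neighbours x :&: S|.
Proof.
move=> /eqP yz xy xz yS zS; have <- : #|[set y; z]| = 2 by rewrite cards2 yz.
apply: subset_leq_card; apply/subsetP => u; rewrite !inE.
by case/orP=> /eqP ->; rewrite ?xy ?xz ?yS ?zS.
Qed.

Lemma degree_le_size x (s : seq sharp_graph) :
  (forall y, adj x y -> y \in s) -> degree x <= size s.
Proof.
move=> sub; apply: leq_trans (card_size s); apply: subset_leq_card.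
by apply/subsetP => y; rewrite inE; apply: sub.
Qed.

Lemma sharp_degree_ge2 x : 0 < n -> 2 <= degree x.
Proof.
move=> n_gt0; rewrite /degree -[neighbours x]setIT.
case: x => [[o s] [t|]].
- by apply: (@two_neighbours _ _ (o, ~~ s, Some true) (o, ~~ s, Some false));
    rewrite ?inE //= ?eqxx //; case: s.
- case: o => [i|].
    by apply: (@two_neighbours _ _ (Some i, s, Some true) (Some i, s, Some false));
      rewrite ?inE //= ?eqxx.
  by apply: (@two_neighbours _ _ (None, ~~ s, None) (Some (Ordinal n_gt0), ~~ s, None));
    rewrite ?inE //= ?eqxx //; case: s.
Qed.

Lemma sharp_degree_hub s : degree ((None, s, None) : sharp_graph) = n.+1.
Proof.
have inj : injective (fun o : option 'I_n => (o, ~~ s, @None bool)) by move=> ? ? [].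
rewrite /degree -[RHS](_ : #|[set (o, ~~ s, @None bool) | o : option 'I_n]| = _).
  apply: eq_card => -[[o s'] k]; rewrite !inE /=.
  apply/idP/imsetP => [|[o' _ [-> -> ->]]]; last by case: {inj} s.
  case: k => [t|]; rewrite ?andbF //= andbT => ss'; exists o => //.
  by case: {inj} s s' ss' => [] [].
by rewrite card_imset // card_option card_ord.
Qed.

Lemma sharp_degree_le x : 3 <= n -> degree x <= n.+1.
Proof.
move=> n_ge3; case: x => [[o s] [t|]].
- apply: leq_trans (n_ge3 : 4 <= n.+1).
  apply: (@degree_le_size _ [:: (o, ~~ s, Some true); (o, ~~ s, Some false);
                                (o, true, None); (o, false, None)]).
  move=> [[o' s'] [t'|]] /=; rewrite !inE !xpair_eqE /=.
    by case/andP=> /eqP -> ; rewrite eqxx; case: s s' t' => [] [] [].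
  by case/and3P=> /eqP ->; rewrite eqxx; case: s' => /=; rewrite ?orbT.
- case: o => [i|]; last by rewrite sharp_degree_hub.
  apply: leq_trans (n_ge3 : 4 <= n.+1).
  apply: (@degree_le_size _ [:: (Some i, s, Some true); (Some i, s, Some false);
                                (Some i, ~~ s, Some true); (None, ~~ s, None)]).
  move=> [[o' s'] [t'|]] /=; rewrite !inE !xpair_eqE /=.
    by case/andP=> /eqP <-; rewrite eqxx; case: s s' t' => [] [] [].
  by case/andP=> + /eqP ->; case: s s' => [] [].
Qed.

Lemma sharp_min_degree : 0 < n -> min_degree sharp_graph = 2.
Proof.
move=> n_gt0; apply/eqP; rewrite eqn_leq; apply/andP; split.
  apply: leq_trans (@min_degree_le sharp_graph (None, true, Some true)) _.
  apply: (@degree_le_size _ [:: (None, false, Some true); (None, false, Some false)]).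
  move=> [[o' s'] [t'|]] /=; rewrite !inE !xpair_eqE /=.
    by case/andP=> /eqP <-; case: s' t' => [] [].
  by rewrite andbF.
apply: min_degree_ge => [|x]; last exact: sharp_degree_ge2.
(* The neutral value [#|G|] of the minimum must be at least 2 as well. *)
apply: leq_trans (max_card (neighbours ((None, true, None) : sharp_graph))).
exact: sharp_degree_ge2.
Qed.

Lemma sharp_max_degree : 3 <= n -> max_degree sharp_graph = n.+1.
Proof.
move=> n_ge3; apply/eqP; rewrite eqn_leq; apply/andP; split.
  by apply/bigmax_leqP => x _; apply: sharp_degree_le.
by rewrite -(sharp_degree_hub true) degree_le_max.
Qed.

Definition label x : bool * option 'I_n :=
  let: (o, s, k) := x in (s, if k is Some _ then None else o).

Definition label_class l : {set sharp_graph} := [set x | label x == l].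

Definition sharp_partition : {set {set sharp_graph}} :=
  [set label_class l | l : bool * option 'I_n].

Lemma mem_label_class s o : (o, s, None) \in label_class (s, o).
Proof. by rewrite inE. Qed.

Lemma label_class_inj : injective label_class.
Proof.
move=> [s o] l eq_l; have := mem_label_class s o.
by rewrite eq_l inE => /eqP.
Qed.

Lemma card_sharp_partition : #|sharp_partition| = 2 * n.+1.
Proof.
by rewrite card_imset ?card_prod ?card_bool ?card_option ?card_ord //;
  apply: label_class_inj.
Qed.

(** The neighbours of [(None, ~~ s, None)] lie in pairwise distinct classes, so no class of side [s]
    contains two of them. *)
Lemma label_class_ndom s o : ~~ two_dominating (label_class (s, o)).
Proof.
apply/forallPn; exists (None, ~~ s, None); rewrite negb_imply inE /=.
rewrite xpair_eqE; apply/andP; split; first by case: s.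
rewrite -ltnNge ltnS -(cards1 ((o, s, None) : sharp_graph)).
apply: subset_leq_card; apply/subsetP => -[[o' s'] [t|]]; rewrite !inE /=.
  by rewrite andbF.
by rewrite !xpair_eqE => /andP[_ /andP[-> ->]].
Qed.

(** The large set of side [s] already dominates twice every vertex outside it except
    [(None, ~~ s, None)], which lacks one neighbour; the singleton supplies it. *)
Lemma label_class_coalition s i :
  two_coalition (label_class (s, Some i)) (label_class (s, None)).
Proof.
apply/and4P; split; rewrite ?label_class_ndom //.
  rewrite -setI_eq0; apply/eqP/setP => x; rewrite !inE.
  by apply/negP => /andP[/eqP -> /eqP].
apply/forallP => -[[o s'] k]; apply/implyP; rewrite !inE /= !xpair_eqE.
case: (eqVneq s' s) => [->|s's] /=; last have {s' s's}-> : s' = ~~ s.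
- case: k => [t|]; first by rewrite orbT.
  case: o => [j|]; last by rewrite orbT.
  by move=> _; apply: (@two_neighbours _ _ (Some j, s, Some true) (Some j, s, Some false));
    rewrite ?inE //= ?eqxx ?orbT.
- by case: s s' s's => [] [].
- move=> _; case: k => [t|].
    by apply: (@two_neighbours _ _ (o, s, Some true) (o, s, Some false));
      rewrite ?inE /= ?eqxx ?orbT //; case: s.
  case: o => [j|].
    by apply: (@two_neighbours _ _ (Some j, s, Some true) (None, s, None));
      rewrite ?inE /= ?eqxx ?orbT //; case: s.
  by apply: (@two_neighbours _ _ (None, s, None) (Some i, s, None));
    rewrite ?inE /= ?eqxx ?orbT //; case: s.
Qed.

Lemma sharp_partitionP : 0 < n -> two_coalition_partition sharp_partition.
Proof.
move=> n_gt0; apply/andP; split.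
  apply/and3P; split.
  - apply/eqP/setP => x; rewrite inE; apply/bigcupP.
    by exists (label_class (label x)); rewrite ?imset_f ?inE.
  - apply/trivIsetP => _ _ /imsetP[l _ ->] /imsetP[l' _ ->] ll'.
    rewrite -setI_eq0; apply/eqP/setP => x; rewrite !inE.
    by apply/negP => /andP[/eqP xl /eqP xl']; rewrite -xl xl' eqxx in ll'.
  - apply/imsetP => -[[s o] _ e0]; have := mem_label_class s o.
    by rewrite -e0 inE.
apply/forall_inP => _ /imsetP[[s o] _ ->]; apply/orP; right; apply/exists_inP.
case: o => [i|].
  exists (label_class (s, None)); rewrite ?imset_f // label_class_coalition.
  by rewrite (inj_eq label_class_inj) xpair_eqE andbF.
pose i := Ordinal n_gt0; exists (label_class (s, Some i)); rewrite ?imset_f //.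
rewrite (inj_eq label_class_inj) xpair_eqE andbF /=.
have /and4P[d n1 n2 u] := label_class_coalition s i.
by rewrite /two_coalition disjoint_sym d n1 n2 setUC.
Qed.

End Sharpness.

Theorem theorem2p4 :
  (forall (G : sgraph),
     2 <= min_degree G ->
     4 * (min_degree G)./2 <= max_degree G ->
     two_coalition_number G <=
       (max_degree G - 2 * (min_degree G)./2 + 1) * ((min_degree G)./2 + 1)
       + uphalf (min_degree G) + 1)
  /\
  (forall (d : nat), 4 <= d ->
     exists G : sgraph,
       [/\ min_degree G = 2,
           max_degree G = d,
           two_coalition_number G =
             (max_degree G - 2 * (min_degree G)./2 + 1)
               * ((min_degree G)./2 + 1)
             + uphalf (min_degree G) + 1
         & two_coalition_number G = 2 * d]).
Proof.
have upper (G : sgraph) : 2 <= min_degree G ->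
    4 * (min_degree G)./2 <= max_degree G -> two_coalition_number G <=
    (max_degree G - 2 * (min_degree G)./2 + 1) * ((min_degree G)./2 + 1)
    + uphalf (min_degree G) + 1.
  move=> min2 max4; apply/bigmax_leqP => P.
  exact: two_coalition_partition_bound.
split=> [//|[//|n] n_ge3].
have n_gt0 : 0 < n by apply: (@leq_trans 3).
have minG := sharp_min_degree n_gt0; have maxG := sharp_max_degree n_ge3.
exists (sharp_graph n).
have boundE : (max_degree (sharp_graph n) - 2 * (min_degree (sharp_graph n))./2 + 1)
    * ((min_degree (sharp_graph n))./2 + 1)
    + uphalf (min_degree (sharp_graph n)) + 1 = 2 * n.+1.
  by rewrite minG maxG /=; lia.
have C2 : two_coalition_number (sharp_graph n) = 2 * n.+1.
  apply/eqP; rewrite eqn_leq -{1}boundE upper ?minG ?maxG //=.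
  rewrite -card_sharp_partition.
  exact: (@leq_bigmax_cond _ _ (fun P : {set {set sharp_graph n}} => #|P|) _
           (sharp_partitionP n_gt0)).
by split; rewrite // boundE.
Qed.
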